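(* Let $A:=(V,m_2)$ be a strictly graded commutative algebra. For all $n\ge3$ the assignment $m=m_2+m_3+\dots+m_{n-1}\mapsto\mathrm{Obs}(m):=\frac12\sum_{i+j=n+2,\ 3\le i,j\le n-1}[m_i,m_j]$ induces a map $$\mathrm{Obs}_n:\mathcal C_n(A)\to H^{n+1,3}_{\mathrm{Harr}}(A,A),\qquad m\mapsto\mathrm{Obs}(m).$$ The kernel of this map (the preimage of $0$) consists of precisely those $C_n$-structures which are extendable: $$\{m\in\mathcal C_n(A): m\text{ is extendable}\}=\ker(\mathrm{Obs}_n).$$
   Context: Conventions. $\mathbb K$ is an evenly graded commutative ring containing $\mathbb Q$; modules are graded $\mathbb K$-modules, cohomologically graded, with the Koszul sign rule. $(\Sigma V)^i=V^{i+1}$, $(\Sigma^{-1}V)^i=V^{i-1}$; $\Sigma V^*$ means $\mathrm{Hom}_{\mathbb K}(\Sigma V,\mathbb K)$. Profinite modules are inverse limits of free modules of finite rank. For $W$ profinite, $\widehat TW=\prod_{i\ge0}W^{\hat\otimes i}$ and $\widehat LW\subset\widehat TW$ is the Lie subalgebra of convergent (possibly infinite) linear combinations of Lie monomials. Vector field = continuous derivation; diffeomorphism = invertible continuous homomorphism; $\mathrm{Der}(X)$, $\mathrm{Aut}(X)$ are the Lie algebra and group of these. Elements of $W^{\hat\otimes n}$ have order $n$; an endomorphism of $\widehat LW$ has order $n$ if it takes elements of order $i$ to elements of order $i+n-1$. $(n)$ denotes the module of continuous endomorphisms of $\widehat L\Sigma V^*$ of order $\ge n$. A diffeomorphism is pointed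 if it is of the form $\mathrm{id}+\phi_2+\phi_3+\cdots$ with $\phi_i$ an endomorphism of order $i$. Minimal $C_n$-structures. Let $V$ be a free graded module, $n\ge3$. A minimal $C_n$-structure on $V$ is a vector field $m\in\mathrm{Der}(\widehat L\Sigma V^* )$ of degree one of the form $m=m_2+\dots+m_{n-1}$, $m_i$ of order $i$, with $m^2=0\mod(n+1)$. Its part $m_2$ determines a strictly graded commutative algebra $(V,m_2)$; conversely strictly graded commutative algebra structures on $V$ are given by vector fields $m_2$ of order 2 and degree one with $m_2^2=0$. Two minimal $C_n$-structures $m,m'$ are equivalent if there is a pointed diffeomorphism $\phi$ (of degree zero) with $\phi\circ m\circ\phi^{-1}=m'\mod(n)$. $\mathcal C_n(A)$ is the set of minimal $C_n$-structures on $V$ with quadratic part the given $m_2$ modulo equivalence. A minimal $C_n$-structure $m$ is extendable if there is a vector field $m_n$ of order $n$ and degree one such that $m+m_n$ is a minimal $C_{n+1}$-structure. Harrison cohomology. $C^\bullet_{\mathrm{Harr}}(A,A)=\Sigma^{-1}\mathrm{Der}(\widehat L\Sigma V^* )$ with differential $\xi\mapsto[m_2,\xi]$; $\xi$ has bidegree $(i,j)$ if it is a vector field of order $i$ and has degree $j$ in $\Sigma^{-1}\mathrm{Der}$ (i.e. degree $j-1$ as a vector field). The differential has bidegree $(1,1)$, and $H^{ij}_{\mathrm{Harr}}(A,A)$ is the resulting bigraded cohomology. *)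

(* Defs.v *)
From HB Require Import structures.
From mathcomp Require Import all_boot all_order all_algebra.
From mathcomp Require Import boolp classical_sets functions.

Set Implicit Arguments.
Unset Strict Implicit.
Unset Printing Implicit Defensive.

Import GRing.Theory.
Import Quotient.

Local Open Scope classical_set_scope.
Local Open Scope ring_scope.

Definition is_grading (M : zmodType) (G : int -> set M) : Prop :=
  [/\ forall i, G i 0,
      forall i x y, G i x -> G i y -> G i (x - y),
      forall x, exists s : seq int, exists c : int -> M,
        [/\ uniq s, forall i, G i (c i) & x = \sum_(i <- s) c i]
    & forall (s : seq int) (c : int -> M), uniq s -> (forall i, G i (c i)) ->
        \sum_(i <- s) c i = 0 -> forall i, i \in s -> c i = 0].

Record even_grading (K : comNzRingType) := EvenGrading {
  kdeg :> int -> set K;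
  kdeg_grading : is_grading kdeg;
  kdeg1 : kdeg 0 1;
  kdegM : forall i j a b, kdeg i a -> kdeg j b -> kdeg (i + j) (a * b);
  kdeg_odd : forall i a, odd (absz i) -> kdeg i a -> a = 0 }.

Record free_gmod (K : comNzRingType) (gK : even_grading K) := FreeGMod {
  fg_mod :> lmodType K;
  fg_deg : int -> set fg_mod;
  fg_grading : is_grading fg_deg;
  fg_degZ : forall i j (a : K) v, gK i a -> fg_deg j v -> fg_deg (i + j) (a *: v);
  bidx : choiceType;
  bdeg : bidx -> int;
  bas : bidx -> fg_mod;
  bas_deg : forall i, fg_deg (bdeg i) (bas i);
  bas_span : forall v, exists s : seq bidx, exists c : bidx -> K,
    v = \sum_(i <- s) c i *: bas i;
  bas_free : forall (s : seq bidx) (c : bidx -> K), uniq s ->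
    \sum_(i <- s) c i *: bas i = 0 -> forall i, i \in s -> c i = 0 }.

(* [K] is concentrated in even degrees, so scalars never produce a sign. *)
Definition koszul (K : pzRingType) (a b : int) : K := (-1) ^+ absz (a * b).
Arguments koszul : clear implicits.

(* Let [e_i] be the chosen homogeneous basis of [V].  Then [Hom_K(Sigma V, K)]
   is the product of the lines [K t_i], where [t_i] is dual to [Sigma e_i];
   as [(Sigma V)^k = V^(k+1)], the degree of [Sigma e_i] is [|e_i| - 1] and
   that of [t_i] is [1 - |e_i|].  The n-th completed tensor power is the
   product of the lines spanned by the words [t_(i_1) ... t_(i_n)], and the
   completed tensor algebra consists of the noncommutative power series
   [\sum_w x(w) t_w], encoded by the coefficient function [x]. *)
Section Series.
Variables (K : comNzRingType) (gK : even_grading K) (V : free_gmod gK).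

Definition word := seq (bidx V).
Definition series := word -> K^o.

HB.instance Definition _ := GRing.Lmodule.on series.

Definition wdeg (w : word) : int := \sum_(i <- w) (1 - bdeg i).

Definition shomog (j : int) (x : series) : Prop :=
  forall w, gK (j - wdeg w) (x w).

(* Elements of the direct sum of the homogeneous parts. *)
Definition sgraded (x : series) : Prop :=
  exists2 s : seq series, forall y, y \in s -> exists j, shomog j y
                        & x = \sum_(y <- s) y.

Definition sorder (n : nat) (x : series) : Prop :=
  forall w, size w != n -> x w = 0.

Definition sorder_ge (n : nat) (x : series) : Prop :=
  forall w, (size w < n)%N -> x w = 0.

(* The graded commutator [x y - (-1)^(|x||y|) y x], extended bilinearly: the
   coefficients being even, the sign is read off from the words. *)
Definition sbr (x y : series) : series := fun w =>
  \sum_(k < (size w).+1)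
    (x (take k w) * y (drop k w)
     - koszul K (wdeg (take k w)) (wdeg (drop k w))
       * (y (take k w) * x (drop k w))).

Inductive lmon := LGen of bidx V | LBr of lmon & lmon.
HB.instance Definition _ := gen_eqMixin lmon.
HB.instance Definition _ := gen_choiceMixin lmon.

Fixpoint lmon_ser (t : lmon) : series :=
  match t with
  | LGen i => fun w => (w == [:: i])%:R
  | LBr t1 t2 => sbr (lmon_ser t1) (lmon_ser t2)
  end.

(* [x] is the sum of the family [F], with convergence in the inverse limit
   topology: every coefficient receives finitely many contributions. *)
Definition sums_to (J : eqType) (F : J -> series) (x : series) : Prop :=
  forall w, exists s : seq J,
    [/\ uniq s, forall j, j \notin s -> F j w = 0 & x w = \sum_(j <- s) F j w].

Definition slie (x : series) : Prop :=
  exists c : lmon -> K, sums_to (fun t => c t *: lmon_ser t) x.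

Definition lhat_pred : {pred series} := fun x => `[< sgraded x /\ slie x >].

Lemma lhat_predP (x : series) : reflect (sgraded x /\ slie x) (x \in lhat_pred).
Proof. exact: asboolP. Qed.

Lemma sums_to_wit (c : lmon -> K) (x : series) :
  sums_to (fun t => c t *: lmon_ser t) x ->
  exists S : word -> seq lmon, forall w s, uniq s -> {subset S w <= s} ->
    (forall t, t \notin s -> c t * lmon_ser t w = 0) /\
    x w = \sum_(t <- s) c t * lmon_ser t w.
Proof.
move=> /choice[S hS]; exists S => w s us sub; have [uS S0 ->] := hS w.
have S0' t : t \notin S w -> c t * lmon_ser t w = 0 by apply: S0.
split=> [t ts|]; first by apply: S0'; apply: contra ts => /sub.
rewrite [RHS](bigID (mem (S w))) /= [X in _ + X]big1 ?addr0; last by move=> t; exact: S0'.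
rewrite -[RHS]big_filter; apply: perm_big; apply: uniq_perm => //.
  exact: filter_uniq.
by move=> t; rewrite mem_filter; case: (boolP (t \in S w)) => // /sub ->.
Qed.

Lemma slie0 : slie 0.
Proof.
exists (fun _ => 0) => w; exists [::]; split=> // [t _|]; first by rewrite scale0r.
by rewrite big_nil.
Qed.

Lemma slieDZ (a : K) x y : slie x -> slie y -> slie (a *: x + y).
Proof.
move=> [c /sums_to_wit[S hS]] [d /sums_to_wit[S' hS']].
exists (fun t => a * c t + d t) => w; pose s := undup (S w ++ S' w).
have us : uniq s by exact: undup_uniq.
have [||c0 cE] := hS w s => //; first by move=> t; rewrite mem_undup mem_cat => ->.
have [||d0 dE] := hS' w s => //.
  by move=> t; rewrite mem_undup mem_cat orbC => ->.
exists s; split=> // [t ts|].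
  rewrite -[LHS]/((a * c t + d t) * lmon_ser t w).
  by rewrite mulrDl -mulrA c0 // d0 // mulr0 addr0.
rewrite -[LHS]/(a * x w + y w) cE dE mulr_sumr -big_split /=.
by apply: eq_bigr => t _; rewrite -[RHS]/((a * c t + d t) * lmon_ser t w) mulrDl mulrA.
Qed.

Lemma slie_br x y : slie x -> slie y -> slie (sbr x y).
Proof.
move=> [c /sums_to_wit[S hS]] [d /sums_to_wit[S' hS']].
pose cd t := if t is LBr t1 t2 then c t1 * d t2 else 0.
exists cd => w.
pose sub (T : word -> seq lmon) := undup (flatten
  [seq T (take k w) ++ T (drop k w) | k <- iota 0 (size w).+1]).
have subP (T : word -> seq lmon) (k : 'I_(size w).+1) :
    {subset T (take k w) <= sub T} /\ {subset T (drop k w) <= sub T}.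
  by split=> t tT; rewrite mem_undup; apply/flatten_mapP; exists (val k);
    rewrite ?mem_iota ?ltn_ord // mem_cat tT ?orbT.
have uT T : uniq (sub T) by exact: undup_uniq.
have hx k := hS _ _ (uT S) (subP S k).1.
have hx' k := hS _ _ (uT S) (subP S k).2.
have hy k := hS' _ _ (uT S') (subP S' k).1.
have hy' k := hS' _ _ (uT S') (subP S' k).2.
have cdE t t' : cd (LBr t t') * lmon_ser (LBr t t') w =
    \sum_(k < (size w).+1)
      ((c t * lmon_ser t (take k w)) * (d t' * lmon_ser t' (drop k w))
      - koszul K (wdeg (take k w)) (wdeg (drop k w)) *
       ((d t' * lmon_ser t' (take k w)) * (c t * lmon_ser t (drop k w)))).
  rewrite mulr_sumr; apply: eq_bigr => k _; rewrite mulrBr /=; congr (_ - _).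
    by rewrite mulrACA.
  by rewrite mulrCA [c t * d t']mulrC mulrACA.
exists [seq LBr t t' | t <- sub S, t' <- sub S']; split.
- by apply: allpairs_uniq => // -[? ?] [? ?] _ _ /= [-> ->].
- case=> [i _|t t']; first by rewrite scale0r.
  move=> tt'; rewrite -[LHS]/(cd (LBr t t') * lmon_ser (LBr t t') w) cdE.
  rewrite big1 // => k _; have [tS|tS] := boolP (t \in sub S); last first.
    by rewrite (hx k).1 // (hx' k).1 // mul0r mulr0 mulr0 subrr.
  have tS' : t' \notin sub S'.
    apply: contra tt' => t'S'; apply/allpairsP; exists (t, t').
    by split.
  by rewrite (hy k).1 // (hy' k).1 // mul0r mulr0 mulr0 subrr.
rewrite big_allpairs_dep /=.
under eq_bigr => t _ do under eq_bigr => t' _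
  do rewrite -[_ w]/(cd (LBr t t') * lmon_ser (LBr t t') w) cdE.
under eq_bigr => t _ do rewrite exchange_big /=.
rewrite exchange_big /=; apply: eq_bigr => k _.
rewrite (hx k).2 (hx' k).2 (hy k).2 (hy' k).2.
under [RHS]eq_bigr => t _ do rewrite sumrB.
rewrite sumrB; congr (_ - _).
  by rewrite mulr_suml; apply: eq_bigr => t _; rewrite mulr_sumr.
rewrite mulrC [X in X * _]mulrC mulr_suml mulr_suml; apply: eq_bigr => t _.
by rewrite -mulr_sumr -mulr_suml mulrC [c t * _ * _]mulrC.
Qed.

Lemma kdeg0 i : gK i 0.
Proof. by case: (kdeg_grading gK). Qed.

Lemma kdegB i a b : gK i a -> gK i b -> gK i (a - b).
Proof. by case: (kdeg_grading gK) => _ + _ _; apply. Qed.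

Lemma kdegD i a b : gK i a -> gK i b -> gK i (a + b).
Proof.
by move=> ia ib; rewrite -[b]opprK; apply: kdegB => //; rewrite -sub0r; apply/kdegB/ib/kdeg0.
Qed.

Lemma kdeg_sum i (J : Type) (s : seq J) (F : J -> K) :
  (forall j, gK i (F j)) -> gK i (\sum_(j <- s) F j).
Proof.
by move=> iF; apply: big_ind => // [|a b]; [exact: kdeg0|exact: kdegD].
Qed.

Lemma kdeg_sign i (n : nat) a : gK i a -> gK i ((-1) ^+ n * a).
Proof.
move=> ia; rewrite -signr_odd; case: odd; rewrite ?mulN1r ?mul1r //.
by rewrite -sub0r; apply: kdegB => //; exact: kdeg0.
Qed.

Lemma shomog_br i j x y : shomog i x -> shomog j y -> shomog (i + j) (sbr x y).
Proof.
move=> ix jy w; apply: kdeg_sum => k.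
have wE : wdeg w = wdeg (take k w) + wdeg (drop k w).
  by rewrite /wdeg -big_cat cat_take_drop.
rewrite wE; apply: kdegB; last apply: kdeg_sign.
  by rewrite opprD addrACA; exact: kdegM.
by rewrite [i + j]addrC opprD addrACA; exact: kdegM.
Qed.

Lemma sgraded_homog j x : shomog j x -> sgraded x.
Proof.
move=> jx; exists [:: x]; last by rewrite big_seq1.
by move=> y; rewrite inE => /eqP ->; exists j.
Qed.

Lemma sgraded0 : sgraded 0.
Proof. by exists [::]; rewrite ?big_nil. Qed.

Lemma sgradedD x y : sgraded x -> sgraded y -> sgraded (x + y).
Proof.
move=> [s hs ->] [t ht ->]; exists (s ++ t); last by rewrite big_cat.
by move=> z; rewrite mem_cat => /orP[/hs|/ht].
Qed.

Lemma sgraded_sum (J : eqType) (s : seq J) (F : J -> series) :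
  (forall j, j \in s -> sgraded (F j)) -> sgraded (\sum_(j <- s) F j).
Proof.
move=> h; rewrite big_seq; apply: big_ind => //; [exact: sgraded0|exact: sgradedD].
Qed.

Lemma sgradedZ (a : K) x : sgraded x -> sgraded (a *: x).
Proof.
move=> [s hs ->]; rewrite scaler_sumr; apply: sgraded_sum => y /hs[j jy].
case: (kdeg_grading gK) => _ _ /(_ a)[t [c [_ tc ->]]] _.
rewrite scaler_suml; apply: sgraded_sum => i _; apply: (@sgraded_homog (i + j)).
by move=> w; rewrite -addrA; apply: kdegM.
Qed.

Lemma sbr_suml (s : seq series) y :
  sbr (\sum_(x <- s) x) y = \sum_(x <- s) sbr x y.
Proof.
elim: s => [|x s ih]; last rewrite !big_cons -ih; last first.
  apply/funext => w; rewrite -[RHS]/(sbr x y w + sbr (\sum_(x <- s) x) y w).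
  rewrite -big_split /=; apply: eq_bigr => k _.
  rewrite ![(x + _) _]/(_ + _) /= mulrDl mulrDr mulrDr opprD addrACA.
  by [].
rewrite !big_nil; apply/funext => w; rewrite /sbr big1 // => k _.
by rewrite mul0r !mulr0 subrr.
Qed.

Lemma sbr_sumr (s : seq series) y :
  sbr y (\sum_(x <- s) x) = \sum_(x <- s) sbr y x.
Proof.
elim: s => [|x s ih]; last rewrite !big_cons -ih; last first.
  apply/funext => w; rewrite -[RHS]/(sbr y x w + sbr y (\sum_(x <- s) x) w).
  rewrite -big_split /=; apply: eq_bigr => k _.
  rewrite ![(x + _) _]/(_ + _) /= mulrDl mulrDr mulrDr opprD addrACA.
  by [].
rewrite !big_nil; apply/funext => w; rewrite /sbr big1 // => k _.
by rewrite mul0r !mulr0 subrr.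
Qed.

Lemma sgraded_br x y : sgraded x -> sgraded y -> sgraded (sbr x y).
Proof.
move=> [s hs ->] [t ht ->]; rewrite sbr_suml; apply: sgraded_sum => {}x /hs[i ix].
rewrite sbr_sumr; apply: sgraded_sum => {}y /ht[j jy].
exact: sgraded_homog (shomog_br ix jy).
Qed.

Fact lhat_submod_closed : submod_closed lhat_pred.
Proof.
split=> [|a x y /lhat_predP[gx lx] /lhat_predP[gy ly]]; apply/lhat_predP.
  by split; [exact: sgraded0|exact: slie0].
by split; [apply: sgradedD => //; exact: sgradedZ|exact: slieDZ].
Qed.

HB.instance Definition _ :=
  GRing.isSubmodClosed.Build K series lhat_pred lhat_submod_closed.

(* The completed free Lie algebra on [Hom_K(Sigma V, K)]. *)
Record lhat := LHat { lser :> series; lserP : lser \in lhat_pred }.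

HB.instance Definition _ := [isSub for lser].
HB.instance Definition _ := [Choice of lhat by <:].
HB.instance Definition _ := [SubChoice_isSubLmodule of lhat by <:].

Fact lbr_subproof (x y : lhat) : sbr x y \in lhat_pred.
Proof.
move: (lserP x) (lserP y) => /lhat_predP[gx lx] /lhat_predP[gy ly].
by apply/lhat_predP; split; [exact: sgraded_br|exact: slie_br].
Qed.

Definition lbr (x y : lhat) : lhat := LHat (lbr_subproof x y).

(* The topology is the linear one whose basic neighbourhoods of 0 are the
   kernels of the projections onto finitely many coefficients. *)
Definition lcont (f : lhat -> lhat) : Prop :=
  forall w : word, exists F : seq word,
    forall x : lhat, (forall u, u \in F -> lser x u = 0) -> lser (f x) w = 0.

Definition cont_endo (f : lhat -> lhat) : Prop := linear f /\ lcont f.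

Definition endo_deg (d : int) (f : lhat -> lhat) : Prop :=
  forall j (x : lhat), shomog j x -> shomog (j + d) (f x).

(* Nonzero elements of [lhat] have positive order, so the truncated
   predecessor is harmless. *)
Definition endo_order (n : nat) (f : lhat -> lhat) : Prop :=
  forall i (x : lhat), sorder i x -> sorder (i + n).-1 (f x).

Definition endo_ge (n : nat) : set (lhat -> lhat) := [set f |
  cont_endo f /\ forall i (x : lhat), sorder i x -> sorder_ge (i + n).-1 (f x)].

(* Homogeneous vector fields: continuous derivations of degree [d]. *)
Definition vfield (d : int) (xi : lhat -> lhat) : Prop :=
  [/\ cont_endo xi, endo_deg d xi &
      forall j (x y : lhat), shomog j x ->
        xi (lbr x y) = lbr (xi x) y + koszul K d j *: lbr x (xi y)].

Definition vfield_ord (n : nat) (d : int) (xi : lhat -> lhat) : Prop :=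
  vfield d xi /\ endo_order n xi.

(* Commutator in the graded Lie algebra of derivations, for [f] of degree [d]
   and [g] of degree [e]. *)
Definition dbr (d e : int) (f g : lhat -> lhat) : lhat -> lhat :=
  f \o g - koszul K d e *: (g \o f).

Definition cont_hom (phi : lhat -> lhat) : Prop :=
  [/\ cont_endo phi, endo_deg 0 phi &
      forall x y, phi (lbr x y) = lbr (phi x) (phi y)].

(* [phi] and [psi] are mutually inverse diffeomorphisms of degree 0. *)
Definition diffeo_pair (phi psi : lhat -> lhat) : Prop :=
  [/\ cont_hom phi, cont_hom psi, cancel phi psi & cancel psi phi].

(* [phi = id + phi_2 + phi_3 + ...], the sum converging for the filtration by
   order. *)
Definition pointed (phi : lhat -> lhat) : Prop :=
  exists phi_ : nat -> lhat -> lhat,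
    (forall i, (2 <= i)%N -> cont_endo (phi_ i) /\ endo_order i (phi_ i)) /\
    forall N, (2 <= N)%N -> endo_ge N (phi - id - \sum_(2 <= i < N) phi_ i).

Lemma vfield_ord0 n d : vfield_ord n d 0.
Proof.
split; last by move=> i x _ w _.
split; first split.
- by move=> a x y; rewrite -[LHS]/(0 : lhat) -[RHS]/(a *: (0 : lhat) + 0) scaler0 addr0.
- by move=> w; exists [::].
- by move=> j x _ w; exact: kdeg0.
move=> j x y _; apply/val_inj/funext => w /=.
rewrite -[RHS]/(sbr 0 y w + koszul K d j * sbr x 0 w) /sbr !big1 ?mulr0 ?addr0 //.
  by move=> k _; rewrite mul0r !mulr0 subrr.
by move=> k _; rewrite mul0r !mulr0 subrr.
Qed.

Lemma lbrBl x y z : lbr (x - y) z = lbr x z - lbr y z.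
Proof.
apply/val_inj/funext => w; rewrite -[RHS]/(sbr x z w - sbr y z w) -sumrB.
apply: eq_bigr => k _; rewrite -![lser (x - y) _]/(lser x _ - lser y _).
rewrite mulrBl mulrBr mulrBr !opprB addrACA [RHS]addrACA.
by congr (_ + _); rewrite addrC.
Qed.

Lemma lbrBr x y z : lbr z (x - y) = lbr z x - lbr z y.
Proof.
apply/val_inj/funext => w; rewrite -[RHS]/(sbr z x w - sbr z y w) -sumrB.
apply: eq_bigr => k _; rewrite -![lser (x - y) _]/(lser x _ - lser y _).
rewrite mulrBl mulrBr mulrBr !opprB addrACA [RHS]addrACA.
by congr (_ + _); rewrite addrC.
Qed.

Lemma vfield_ordB n d f g :
  vfield_ord n d f -> vfield_ord n d g -> vfield_ord n d (f - g).
Proof.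
move=> [[[lf cf] df ff] of_] [[[lg cg] dg gg] og]; split; last first.
  move=> i x ix w iw; rewrite -[LHS]/(lser (f x) w - lser (g x) w).
  by rewrite (of_ i) // (og i) // subrr.
split; first split.
- move=> a x y; rewrite -![(f - g) _]/(f _ - g _) lf lg scalerBr opprD.
  by rewrite addrACA.
- move=> w; have [F fF] := cf w; have [G gG] := cg w; exists (F ++ G) => x xFG.
  rewrite -[LHS]/(lser (f x) w - lser (g x) w) fF ?gG ?subrr //.
    by move=> u uG; apply: xFG; rewrite mem_cat uG orbT.
  by move=> u uG; apply: xFG; rewrite mem_cat uG.
- by move=> j x jx w; apply: kdegB; [apply: df|apply: dg].
move=> j x y jx; rewrite -![(f - g) _]/(f _ - g _) (ff j) // (gg j) //.
by rewrite lbrBl lbrBr scalerBr opprD addrACA.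
Qed.

Lemma dbrB d e f g h : linear f -> dbr d e f (g - h) = dbr d e f g - dbr d e f h.
Proof.
move=> lf; apply/funext => x.
rewrite -[LHS]/(f (g x - h x) - koszul K d e *: (g (f x) - h (f x))).
rewrite -[RHS]/(f (g x) - koszul K d e *: g (f x)
                - (f (h x) - koszul K d e *: h (f x))).
have fB u v : f (u - v) = f u - f v.
  by have := lf (-1) v u; rewrite !scaleN1r => E; rewrite [u - v]addrC E addrC.
rewrite fB scalerBr !opprB addrACA [RHS]addrACA.
by congr (_ + _); rewrite addrC.
Qed.

Lemma dbr0 d e f : linear f -> dbr d e f 0 = 0.
Proof. by move=> lf; have := dbrB d e 0 0 lf; rewrite !subrr. Qed.

(* A strictly graded commutative algebra structure on [V]. *)
Record sgc_algebra := SGCAlgebra {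
  sgc_m2 :> lhat -> lhat;
  sgc_vfield : vfield_ord 2 1 sgc_m2;
  sgc_sq : forall x, sgc_m2 (sgc_m2 x) = 0 }.

Definition totalf (n : nat) (m : nat -> lhat -> lhat) : lhat -> lhat :=
  \sum_(2 <= i < n) m i.

(* [m] is the family of components [m_2, ..., m_(n-1)]; the values of [m] at
   other indices are irrelevant. *)
Definition is_minCn (n : nat) (m : nat -> lhat -> lhat) : Prop :=
  (forall i, (2 <= i < n)%N -> vfield_ord i 1 (m i)) /\
  endo_ge n.+1 (totalf n m \o totalf n m).

End Series.

Section Obstruction.
Variables (K : comAlgType rat) (gK : even_grading K) (V : free_gmod gK).
Variable (A : sgc_algebra V).
Notation L := (lhat V).

Record minCn (n : nat) := MinCn {
  comp :> nat -> L -> L;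
  minCnP : is_minCn n comp;
  comp2 : comp 2 = A }.

Definition minCn_equiv (n : nat) (m m' : minCn n) : Prop :=
  exists phi psi : L -> L,
    [/\ diffeo_pair phi psi, pointed phi &
        endo_ge n (phi \o totalf n m \o psi - totalf n m')].

Definition Cclass (n : nat) (m : minCn n) : set (minCn n) :=
  [set m' | minCn_equiv m m'].

(* The set C_n(A) of equivalence classes. *)
Record Cn (n : nat) := MkCn {
  Cset :> set (minCn n);
  CsetP : exists m, Cset = Cclass m }.

Definition toCn (n : nat) (m : minCn n) : Cn n :=
  MkCn (ex_intro (fun m0 => Cclass m = Cclass m0) m erefl).

(* [m + mn] is a minimal C_(n+1)-structure for some [mn] of order [n]. *)
Definition extendable (n : nat) (m : minCn n) : Prop :=
  exists mn : L -> L, vfield_ord n 1 mn /\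
    is_minCn n.+1 (fun i => if i == n then mn else m i).

Definition Obs (n : nat) (m : minCn n) : L -> L :=
  ((2%:R^-1 : rat) *: (1 : K)) *:
    \sum_(3 <= i < n) \sum_(3 <= j < n | (i + j == n + 2)%N) dbr 1 1 (m i) (m j).

(* Harrison cochains of bidegree (i, j): because of the desuspension these are
   the vector fields of order [i] and degree [j - 1]. *)
Definition harrC (i : nat) (j : int) : set (L -> L) := vfield_ord i (j - 1).

(* The differential on cochains of bidegree [(_, j)]. *)
Definition harr_d (j : int) (xi : L -> L) : L -> L := dbr 1 (j - 1) A xi.

Definition cocycle_pred (i : nat) (j : int) : {pred L -> L} := fun xi =>
  `[< harrC i j xi /\ harr_d j xi = 0 >].

Lemma sgc_linear : linear A.
Proof. by case: (sgc_vfield A) => -[[]]. Qed.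

Fact cocycle_zmod_closed i j : zmod_closed (cocycle_pred i j).
Proof.
split=> [|f g /asboolP[cf df] /asboolP[cg dg]]; apply/asboolP.
  by split; [exact: vfield_ord0|apply: dbr0; exact: sgc_linear].
split; first exact: vfield_ordB.
by rewrite /harr_d dbrB; [rewrite -/(harr_d j f) df -/(harr_d j g) dg subrr
  |exact: sgc_linear].
Qed.

HB.instance Definition _ i j :=
  GRing.isZmodClosed.Build (L -> L) (cocycle_pred i j) (cocycle_zmod_closed i j).

Record cocycle (i : nat) (j : int) :=
  Cocycle { cocycle_val :> L -> L; cocycleP : cocycle_val \in cocycle_pred i j }.

HB.instance Definition _ i j := [isSub for @cocycle_val i j].
HB.instance Definition _ i j := [Choice of cocycle i j by <:].
HB.instance Definition _ i j := [SubChoice_isSubZmodule of cocycle i j by <:].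

(* Nonzero vector fields have positive order, so the truncated predecessor is
   harmless. *)
Definition cobound_pred (i : nat) (j : int) : {pred cocycle i j} := fun xi =>
  `[< exists2 eta, harrC i.-1 (j - 1) eta & cocycle_val xi = harr_d (j - 1) eta >].

Fact cobound_zmod_closed i j : zmod_closed (@cobound_pred i j).
Proof.
split=> [|f g /asboolP[f' cf fE] /asboolP[g' cg gE]]; apply/asboolP.
  by exists 0; [exact: vfield_ord0|rewrite /harr_d dbr0 //; exact: sgc_linear].
exists (f' - g'); first exact: vfield_ordB.
rewrite /harr_d dbrB; last exact: sgc_linear.
by rewrite -/(harr_d (j - 1) f') -fE -/(harr_d (j - 1) g') -gE.
Qed.

HB.instance Definition _ i j := GRing.isZmodClosed.Build (cocycle i j)
  (@cobound_pred i j) (@cobound_zmod_closed i j).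

(* The bigraded Harrison cohomology H^(i,j)(A, A), as an abelian group. *)
Definition HHarr (i : nat) (j : int) := {ideal_quot @cobound_pred i j}.

Definition hclass (i : nat) (j : int) (z : cocycle i j) : HHarr i j :=
  \pi_(HHarr i j)%qT z.

HB.instance Definition _ i j := GRing.Zmodule.on (HHarr i j).

End Obstruction.

(* Main.v *)
Require Import Defs.
From HB Require Import structures.
From mathcomp Require Import all_boot all_order all_algebra.
From mathcomp Require Import boolp classical_sets functions.
From mathcomp Require Import zify.
Import GRing.Theory.
Local Open Scope classical_set_scope.
Local Open Scope ring_scope.

Set Implicit Arguments.
Unset Strict Implicit.
Unset Printing Implicit Defensive.

(* Everything takes place in the ring of continuous linear endomorphisms of the
   completed free Lie algebra, filtered by order.  A leading term is unique,
   because an endomorphism of pure order which also has larger order vanishes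
   on the elements of pure order, hence, by continuity, everywhere.

   For a minimal C_n-structure [m] with total field X, X^2 has leading term
   Obs(m) in order n + 1 and X has leading term m_2.  Comparing leading terms
   in X X^2 = X^2 X shows that Obs(m) is a cocycle, and adding to X a field with
   leading term b in order n adds [m_2, b] to the leading term of X^2; this
   gives the criterion for extendability.  If phi X phi^-1 = X' mod (n), then
   r = phi X phi^-1 - X' is a vector field with a leading term eta in order n,
   and comparing the leading terms of (X' + r)^2 = phi X^2 phi^-1 gives
   Obs(m) = Obs(m') + [m_2, eta].  The leading term eta is obtained from the
   components of phi and m only, because r phi = phi X - X' phi. *)

(** * Order components *)

Section OrderParts.
Variables (K : comNzRingType) (gK : even_grading K) (V : free_gmod gK).
Notation L := (lhat V).
Implicit Types (x y z : L) (w : word V).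

Lemma sorder_geW i j (x : series V) : (j <= i)%N -> sorder_ge i x -> sorder_ge j x.
Proof. by move=> ji ix w wj; apply: ix; apply: leq_trans ji. Qed.

Lemma sorderW i (x : series V) : sorder i x -> sorder_ge i x.
Proof. by move=> ix w wi; apply: ix; rewrite neq_ltn wi. Qed.

Lemma sorder_ge_sbr i j (x y : series V) :
  sorder_ge i x -> sorder_ge j y -> sorder_ge (i + j) (sbr x y).
Proof.
move=> ix jy w wij; rewrite /sbr big1 // => k _.
have E : size w = (size (take k w) + size (drop k w))%N by rewrite -size_cat cat_take_drop.
have h1 : x (take k w) * y (drop k w) = 0.
  have [/ix -> | t1] := ltnP (size (take k w)) i; first by rewrite mul0r.
  by rewrite jy ?mulr0 //; lia.
have h2 : y (take k w) * x (drop k w) = 0.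
  have [/jy -> | t1] := ltnP (size (take k w)) j; first by rewrite mul0r.
  by rewrite ix ?mulr0 //; lia.
by rewrite h1 h2 mulr0 subrr.
Qed.

Lemma sorder_sbr i j (x y : series V) :
  sorder i x -> sorder j y -> sorder (i + j) (sbr x y).
Proof.
move=> ix jy w wij; rewrite /sbr big1 // => k _.
have E : size w = (size (take k w) + size (drop k w))%N by rewrite -size_cat cat_take_drop.
have h1 : x (take k w) * y (drop k w) = 0.
  have [t1|/ix -> ] := eqVneq (size (take k w)) i; last by rewrite mul0r.
  by rewrite jy ?mulr0 //; lia.
have h2 : y (take k w) * x (drop k w) = 0.
  have [t1|/jy ->] := eqVneq (size (take k w)) j; last by rewrite mul0r.
  by rewrite ix ?mulr0 //; lia.
by rewrite h1 h2 mulr0 subrr.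
Qed.

Fixpoint lmon_size (t : lmon V) : nat :=
  if t is LBr t1 t2 then (lmon_size t1 + lmon_size t2)%N else 1%N.

Lemma sorder_lmon (t : lmon V) : sorder (lmon_size t) (lmon_ser t).
Proof.
elim: t => [i|t1 h1 t2 h2] /=; last exact: sorder_sbr.
by move=> w; have [->|] := eqVneq w [:: i].
Qed.

(** A Lie monomial is supported on words of its own length. Taking the coefficient of each monomial
    [t] from the expansion of [z (lmon_size t)] therefore leaves the coefficients at words of other
    lengths untouched. *)
Lemma slie_glue (z : nat -> series V) :
  (forall k, slie (z k)) -> slie (fun w => z (size w) w).
Proof.
move=> /choice[c cz]; exists (fun t => c (lmon_size t) t) => w.
have [s [us s0 sE]] := cz (size w) w.
have cE t : ((c (lmon_size t) t *: lmon_ser t) : series V) w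
          = ((c (size w) t *: lmon_ser t) : series V) w.
  rewrite -[LHS]/(c (lmon_size t) t * lmon_ser t w) -[RHS]/(c (size w) t * lmon_ser t w).
  have [->//|ne] := eqVneq (size w) (lmon_size t).
  by rewrite sorder_lmon // !mulr0.
exists s; split=> // [t /s0|]; first by rewrite cE.
by rewrite sE; apply: eq_bigr => t _; rewrite cE.
Qed.

Definition spart (k : nat) (x : series V) : series V :=
  fun w => if size w == k then x w else 0.

Lemma shomog_spart k j (x : series V) : shomog j x -> shomog j (spart k x).
Proof. by move=> jx w; rewrite /spart; case: eqP => _; [exact: jx|exact: kdeg0]. Qed.

Fact part_subproof k x : spart k x \in @lhat_pred K gK V.
Proof.
move: (lserP x) => /lhat_predP[[s hs xE] lx]; apply/lhat_predP; split.
  have -> : spart k x = \sum_(y <- s) spart k y.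
    rewrite xE; elim: (s) => [|y r ih]; last rewrite !big_cons -ih; last first.
      apply/funext => w; rewrite -[RHS]/(spart k y w + spart k (\sum_(z <- r) z) w).
      by rewrite /spart; case: eqP; rewrite ?addr0.
    by rewrite !big_nil; apply/funext => w; rewrite /spart; case: eqP.
  by apply: sgraded_sum => y /hs[j jy]; apply: sgraded_homog; apply: shomog_spart jy.
(* The truncation is glued from [x] in length [k] and [0] in every other length. *)
have -> : spart k x = fun w => (if size w == k then lser x else 0) w.
  by apply/funext => w; rewrite /spart; case: eqP.
apply: (@slie_glue (fun i => if i == k then lser x else 0)) => i.
by case: eqP => _ //; exact: slie0.
Qed.

Definition part k x : L := LHat (part_subproof k x).

Lemma sorder_part k x : sorder k (part k x).
Proof. by move=> w /negPf wk; rewrite /= /spart wk. Qed.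

Lemma shomog_part k j x : shomog j x -> shomog j (part k x).
Proof. exact: shomog_spart. Qed.

Lemma lser_sum (J : Type) (s : seq J) (P : pred J) (f : J -> L) w :
  lser (\sum_(j <- s | P j) f j) w = \sum_(j <- s | P j) lser (f j) w.
Proof. by elim/big_ind2 : _ => // x a y b <- <-. Qed.

Lemma part_tail N x : sorder_ge N (x - \sum_(k < N) part k x).
Proof.
move=> w wN; rewrite -[LHS]/(lser x w - lser (\sum_(k < N) part k x) w).
rewrite lser_sum (bigD1 (Ordinal wN)) //= big1 ?addr0.
  by rewrite /spart eqxx subrr.
move=> i /eqP iw; rewrite /spart; case: eqP => // wi.
by case: iw; apply: val_inj.
Qed.

Lemma part_ge0 i k x : sorder_ge i x -> (k < i)%N -> part k x = 0.
Proof.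
move=> ix ki; apply/val_inj/funext => w /=; rewrite /spart; case: eqP => // wk.
by apply: ix; rewrite wk.
Qed.

Lemma linearf_sum (f : L -> L) (J : Type) (s : seq J) (F : J -> L) :
  linear f -> f (\sum_(j <- s) F j) = \sum_(j <- s) f (F j).
Proof.
move=> lf; have fD u v : f (u + v) = f u + f v by have := lf 1 u v; rewrite !scale1r.
have f0 : f 0 = 0 by apply: (addrI (f 0)); rewrite -fD !addr0.
by elim: s => [|j s ih]; rewrite ?big_nil // !big_cons fD ih.
Qed.

Lemma linearfD (f : L -> L) x y : linear f -> f (x + y) = f x + f y.
Proof. by move=> /(_ 1 x y); rewrite !scale1r. Qed.

Lemma linearf0 (f : L -> L) : linear f -> f 0 = 0.
Proof. by move=> lf; apply: (addrI (f 0)); rewrite -linearfD // !addr0. Qed.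

(** By continuity the coefficient of [f x] at [w] depends on finitely many coefficients of [x]. With
    [N] larger than the lengths of the words concerned, the tail of [x] vanishes on all of them. *)
Lemma cont_endo_parts (f : L -> L) x w : cont_endo f ->
  exists N, lser (f x) w = \sum_(k < N) lser (f (part k x)) w.
Proof.
move=> [lf /(_ w)[F fF]]; pose N := (\max_(u <- F) size u).+1; exists N.
rewrite -lser_sum -linearf_sum //.
set y := \sum_(k < N) _; rewrite -[x in LHS](subrK y) linearfD //.
rewrite -[LHS]/(lser (f (x - y)) w + lser (f y) w) fF ?add0r // => u uF.
apply: part_tail; rewrite ltnS.
by rewrite (big_rem u) //= leq_maxl.
Qed.

(** Passes from elements of pure order, on which [endo_ge] is tested, to elements of order at least
    [i]: their parts below [i] vanish, and each remaining part is raised far enough. *)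
Lemma cont_endo_ge (f : L -> L) a : cont_endo f ->
  (forall i x, sorder i x -> sorder_ge (i + a) (f x)) ->
  forall i x, sorder_ge i x -> sorder_ge (i + a) (f x).
Proof.
move=> cf fa i x ix w wia; have [N ->] := cont_endo_parts x w cf.
apply: big1 => k _; have [ki|ik] := ltnP k i.
  by rewrite (part_ge0 ix) // linearf0 //; case: cf.
by apply: (fa k); [exact: sorder_part|apply: leq_trans wia _; rewrite leq_add2r].
Qed.

Lemma cont_endo_order_ge_eq0 (f : L -> L) a : cont_endo f ->
  (forall i x, sorder i x -> sorder (i + a) (f x)) ->
  (forall i x, sorder_ge i x -> sorder_ge (i + a).+1 (f x)) -> f = 0.
Proof.
move=> cf fo fg; apply/funext => x; apply/val_inj/funext => w.
rewrite -[RHS]/(0 : K) -[LHS]/(lser (f x) w).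
have [N ->] := cont_endo_parts x w cf; apply: big1 => k _.
have [wk|wk] := eqVneq (size w) (k + a)%N; last by apply: (fo k) => //; exact: sorder_part.
by apply: (fg k); [apply: sorderW; exact: sorder_part|rewrite wk].
Qed.

End OrderParts.

(** * Vector fields *)

Section VectorFields.
Variables (K : comNzRingType) (gK : even_grading K) (V : free_gmod gK).
Notation L := (lhat V).
Implicit Types (x y z : L) (w : word V).

Lemma lhatP x y : (forall w, lser x w = lser y w) -> x = y.
Proof. by move=> xy; apply/val_inj/funext. Qed.

Lemma linearfZ (f : L -> L) (a : K) x : linear f -> f (a *: x) = a *: f x.
Proof. by move=> lf; rewrite -[a *: x]addr0 lf (linearf0 lf) addr0. Qed.

Lemma lbr0l z : lbr 0 z = 0.
Proof. by have := lbrBl 0 0 z; rewrite !subrr. Qed.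

Lemma lbr0r z : lbr z 0 = 0.
Proof. by have := lbrBr 0 0 z; rewrite !subrr. Qed.

Lemma lbrDl x y z : lbr (x + y) z = lbr x z + lbr y z.
Proof. by rewrite -[y in LHS]opprK lbrBl -[- y]sub0r lbrBl lbr0l sub0r opprK. Qed.

Lemma lbrDr x y z : lbr z (x + y) = lbr z x + lbr z y.
Proof. by rewrite -[y in LHS]opprK lbrBr -[- y]sub0r lbrBr lbr0r sub0r opprK. Qed.

Lemma lbrZl (a : K) x z : lbr (a *: x) z = a *: lbr x z.
Proof.
apply/lhatP => w; rewrite -[RHS]/(a * sbr x z w) mulr_sumr.
apply: eq_bigr => k _; rewrite -![lser (a *: x) _]/(a * lser x _) mulrBr -mulrA.
by congr (_ - _); rewrite [RHS]mulrCA; congr (_ * _); rewrite mulrCA.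
Qed.

Lemma lbrZr (a : K) x z : lbr z (a *: x) = a *: lbr z x.
Proof.
apply/lhatP => w; rewrite -[RHS]/(a * sbr z x w) mulr_sumr.
apply: eq_bigr => k _; rewrite -![lser (a *: x) _]/(a * lser x _) mulrBr -mulrA.
by congr (_ - _); rewrite mulrCA.
Qed.

(* On elements of pure order, [g] agrees with [f] in the lowest possible order;
   continuity extends the derivation rule to all elements. *)
Lemma vfield_leading a d (f g : L -> L) : vfield d f -> cont_endo g ->
  (forall i x, sorder i x -> sorder (i + a) (g x)) ->
  (forall i x, sorder_ge i x -> sorder_ge (i + a).+1 (f x - g x)) ->
  vfield d g.
Proof.
move=> [[lf _] df ff] cg og fg; have [lg _] := cg; split=> //.
  (* The degree is checked on each part of [x]: outside length [k + a] the value of [g] vanishes,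
     and in that length it coincides with the value of [f]. *)
  move=> j x jx w; have [N ->] := cont_endo_parts x w cg.
  apply: kdeg_sum => k; have [wk|wk] := eqVneq (size w) (k + a)%N; last first.
    by rewrite (og k) //; [exact: kdeg0|exact: sorder_part].
  have -> : lser (g (part k x)) w = lser (f (part k x)) w.
    have pk : sorder_ge k (part k x) by apply: sorderW; exact: sorder_part.
    have : lser (f (part k x) - g (part k x)) w = 0 by apply: (fg k) => //; rewrite wk.
    rewrite -[lser (_ - _) w]/(lser (f (part k x)) w - lser (g (part k x)) w).
    by move/eqP; rewrite subr_eq0 => /eqP.
  by apply: df; apply: shomog_part.
move=> j x y jx; set c := koszul K d j.
(* [D h] is the defect of the derivation rule, with the sign belonging to degree [j] held fixed;
   [D g] is biadditive. *)
pose D (h : L -> L) (u v : L) : L := h (lbr u v) - (lbr (h u) v + c *: lbr u (h v)).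
suff D0 : D g x y = 0 by apply/eqP; rewrite -subr_eq0; apply/eqP.
have DDl u u' v : D g (u + u') v = D g u v + D g u' v.
  rewrite /D lbrDl !(linearfD _ _ lg) !lbrDl scalerDr [X in _ - X]addrACA opprD.
  by rewrite addrACA.
have DDr u v v' : D g u (v + v') = D g u v + D g u v'.
  rewrite /D lbrDr !(linearfD _ _ lg) !lbrDr scalerDr [X in _ - X]addrACA opprD.
  by rewrite addrACA.
have gg : forall i x, sorder_ge i x -> sorder_ge (i + a) (g x).
  by apply: cont_endo_ge => // i u /og/sorderW.
have D0r u : D g u 0 = 0 by apply: (addrI (D g u 0)); rewrite -DDr !addr0.
have D0l v : D g 0 v = 0 by apply: (addrI (D g 0 v)); rewrite -DDl !addr0.
have Dge i k b (h : L -> L) (u v : L) : sorder_ge i u -> sorder_ge k v ->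
    (forall i x, sorder_ge i x -> sorder_ge (i + b) (h x)) ->
    sorder_ge (i + k + b) (D h u v).
  move=> iu kv hb w wikb.
  rewrite -[LHS]/(lser (h (lbr u v)) w
     - (sbr (h u) v w + c * sbr u (h v) w)).
  rewrite (hb (i + k)%N) //; last exact: sorder_ge_sbr.
  rewrite (sorder_ge_sbr (hb _ _ iu) kv); last by rewrite addnAC.
  rewrite (sorder_ge_sbr iu (hb _ _ kv)); last by rewrite addnA.
  by rewrite mulr0 addr0 subrr.
have Dord i k (u v : L) : sorder i u -> sorder k v -> sorder (i + k + a) (D g u v).
  move=> iu kv w wik.
  rewrite -[LHS]/(lser (g (lbr u v)) w
     - (sbr (g u) v w + c * sbr u (g v) w)).
  rewrite (og (i + k)%N) //; last exact: sorder_sbr.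
  rewrite (sorder_sbr (og _ _ iu) kv); last by rewrite addnAC.
  rewrite (sorder_sbr iu (og _ _ kv)); last by rewrite addnA.
  by rewrite mulr0 addr0 subrr.
(* As [f] obeys the rule, [D g u v] is minus the defect of [f - g], which starts one order above the
   only order in which [D g u v] can be nonzero. *)
have Dpure i k (u v : L) : shomog j u -> sorder i u -> sorder k v -> D g u v = 0.
  move=> ju iu kv; apply/lhatP => w; rewrite -[RHS]/(0 : K).
  have [wik|wik] := eqVneq (size w) (i + k + a)%N; last exact: (Dord i k).
  have -> : D g u v = - D (fun x => f x - g x) u v.
    rewrite /D (ff j) // lbrBl lbrBr scalerBr -/c [X in - (_ - X)]addrACA -opprD.
    by rewrite opprB opprB [RHS]addrC addrA subrK.
  rewrite -[LHS]/(- lser (D (fun x => f x - g x) u v) w) (Dge i k a.+1) ?oppr0 //.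
  - exact: sorderW.
  - exact: sorderW.
  - by move=> i' x' ix; rewrite addnS; exact: fg.
  by rewrite wik addnS.
(* Tails of order at least [N] contribute nothing at [w], so both arguments may be replaced by
   finite sums of parts; the parts of [x] still have degree [j], as [Dpure] requires. *)
apply/lhatP => w; rewrite -[RHS]/(0 : K); pose N := (size w).+1.
rewrite -(subrK (\sum_(k < N) part k x) x) DDl.
rewrite -[LHS]/(lser (D g _ y) w + lser (D g (\sum_(k < N) part k x) y) w).
rewrite (Dge N 0%N a) ?add0r //; first last.
- by rewrite addn0 /N addSn ltnS leq_addr.
- exact: part_tail.
rewrite -(subrK (\sum_(k < N) part k y) y) DDr.
rewrite -[LHS]/(lser (D g _ _) w + lser (D g _ (\sum_(k < N) part k y)) w).
rewrite (Dge 0%N N a) ?add0r //; first last.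
- by rewrite /N addSn ltnS leq_addr.
- exact: part_tail.
rewrite (_ : D g _ _ = 0) //.
apply: (big_ind (fun u => D g u _ = 0)) => //.
  by move=> u u' u0 u'0; rewrite DDl u0 u'0 addr0.
move=> i _; apply: (big_ind (fun v => D g _ v = 0)) => //.
  by move=> u u' u0 u'0; rewrite DDr u0 u'0 addr0.
by move=> k _; apply: (Dpure i k); [apply: shomog_part|exact: sorder_part|exact: sorder_part].
Qed.

(** * Closure properties of continuous endomorphisms and vector fields *)

Lemma cont_endoB (f g : L -> L) : cont_endo f -> cont_endo g -> cont_endo (f - g).
Proof.
move=> [lf cf] [lg cg]; split.
  move=> a x y; rewrite -![(f - g) _]/(f _ - g _) lf lg scalerBr opprD.
  by rewrite addrACA.
move=> w; have [F fF] := cf w; have [G gG] := cg w; exists (F ++ G) => x xFG.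
rewrite -[LHS]/(lser (f x) w - lser (g x) w) fF ?gG ?subrr //.
  by move=> u uG; apply: xFG; rewrite mem_cat uG orbT.
by move=> u uG; apply: xFG; rewrite mem_cat uG.
Qed.

Lemma cont_endo0 : cont_endo (0 : L -> L).
Proof.
split=> [a x y|w]; first by rewrite -[LHS]/(0 : L) -[RHS]/(a *: (0 : L) + 0) scaler0 addr0.
by exists [::].
Qed.

Lemma cont_endo_id : cont_endo (id : L -> L).
Proof. by split=> // w; exists [:: w] => x; apply; rewrite mem_head. Qed.

Lemma cont_endo_comp (f g : L -> L) : cont_endo f -> cont_endo g -> cont_endo (f \o g).
Proof.
move=> [lf cf] [lg cg]; split=> [a x y|w]; first by rewrite /= lg lf.
have [F fF] := cf w; have [G gG] := choice cg.
exists (flatten [seq G u | u <- F]) => x xG /=; apply: fF => u uF.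
by apply: gG => v vG; apply: xG; apply/flatten_mapP; exists u.
Qed.

Lemma vfieldB d (f g : L -> L) : vfield d f -> vfield d g -> vfield d (f - g).
Proof.
move=> [cf df ff] [cg dg gg]; split.
- exact: cont_endoB.
- by move=> j x jx w; apply: kdegB; [apply: df|apply: dg].
move=> j x y jx; rewrite -![(f - g) _]/(f _ - g _) (ff j) // (gg j) //.
by rewrite lbrBl lbrBr scalerBr opprD addrACA.
Qed.

Lemma vfield0 d : vfield d (0 : L -> L).
Proof. by case: (vfield_ord0 V 0 d). Qed.

Lemma vfieldD d (f g : L -> L) : vfield d f -> vfield d g -> vfield d (f + g).
Proof.
move=> vf vg; rewrite -[g]opprK -[- g]sub0r; apply: vfieldB => //.
by apply: vfieldB => //; exact: vfield0.
Qed.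

Lemma vfield_sum d (J : eqType) (s : seq J) (P : pred J) (f : J -> L -> L) :
  (forall j, j \in s -> P j -> vfield d (f j)) -> vfield d (\sum_(j <- s | P j) f j).
Proof.
move=> h; rewrite big_seq_cond; apply: big_ind; [exact: vfield0|exact: vfieldD|].
by move=> j /andP[]; exact: h.
Qed.

Lemma koszulDr a b c : koszul K a (b + c) = koszul K a b * koszul K a c.
Proof.
rewrite /koszul -exprD -signr_odd -[in RHS]signr_odd; congr ((-1) ^+ _).
by rewrite mulrDr; congr nat_of_bool; lia.
Qed.

Lemma koszulC a b : koszul K a b = koszul K b a.
Proof. by rewrite /koszul mulrC. Qed.

Lemma koszulDl a b c : koszul K (a + b) c = koszul K a c * koszul K b c.
Proof. by rewrite koszulC koszulDr ![koszul K c _]koszulC. Qed.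

Lemma koszul_sq a b : koszul K a b * koszul K a b = 1.
Proof. by rewrite /koszul -exprD addnn -mul2n exprM sqrrN !expr1n. Qed.

(** The mixed terms in [lbr (g x) (f y)] and [lbr (f x) (g y)] cancel, the latter because the square
    of [koszul K d e] is 1. *)
Lemma vfield_dbr d e (f g : L -> L) : vfield d f -> vfield e g ->
  vfield (d + e) (dbr d e f g).
Proof.
move=> [cf df ff] [cg dg gg]; have [lf _] := cf; have [lg _] := cg.
have dbrE x : dbr d e f g x = f (g x) - koszul K d e *: g (f x) by [].
split.
- apply: cont_endoB; first exact: cont_endo_comp.
  have [lgf cgf] := cont_endo_comp cg cf; split.
    move=> a x y; rewrite -![(_ *: (g \o f)) _]/(_ *: (g \o f) _) lgf scalerDr.
    by rewrite !scalerA [_ * a]mulrC.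
  move=> w; have [F hF] := cgf w; exists F => x /hF gf0.
  by rewrite -[LHS]/(koszul K d e * lser ((g \o f) x) w) gf0 mulr0.
- move=> j x jx w; apply: kdegB.
    by rewrite [d + e]addrC addrA; apply/df/dg.
  by apply: kdeg_sign; rewrite addrA; apply/dg/df.
move=> j x y jx; rewrite !dbrE (gg j) // (ff j) //.
rewrite (linearfD _ _ lf) (linearfD _ _ lg) (linearfZ _ _ lf) (linearfZ _ _ lg).
rewrite (ff (j + e) (g x) y (dg _ _ jx)) (gg (j + d) (f x) y (df _ _ jx)).
rewrite (ff j x (g y) jx) (gg j x (f y) jx).
rewrite lbrBl lbrBr lbrZl lbrZr koszulDl !koszulDr [koszul K e d]koszulC.
set A := lbr (f (g x)) y; set B := lbr (g (f x)) y; set C := lbr x (f (g y)).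
set D := lbr x (g (f y)); set E := lbr (g x) (f y); set F := lbr (f x) (g y).
have := koszul_sq d e.
set k := koszul K d e; set p := koszul K d j; set q := koszul K e j => kk.
rewrite !scalerDr !scalerN !scalerA !opprD.
rewrite [k * (q * k)]mulrCA kk mulr1 [p * k]mulrC [q * p]mulrC.
rewrite [(A + _) + _]addrAC -!addrA; congr (_ + _); rewrite [LHS]addrC -!addrA.
rewrite -[k * p * q]mulrA [k * (p * q)]mulrC [RHS]addrCA; congr (_ + _).
rewrite addrCA; congr (_ + _); rewrite addrCA addNKr.
by rewrite addrCA addNr addr0.
Qed.

Lemma vfield_conj (f phi psi : L -> L) d : diffeo_pair phi psi -> vfield d f ->
  vfield d (phi \o f \o psi).
Proof.
move=> [[cphi dphi hphi] [cpsi dpsi hpsi] phiK psiK] [cf df ff]; split.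
- by apply: cont_endo_comp => //; apply: cont_endo_comp.
- by move=> j x jx /=; rewrite -[j + d]addr0 -[j]addr0; apply/dphi/df/dpsi.
move=> j x y jx /=; have [lphi _] := cphi.
rewrite hpsi (ff j); last by rewrite -[j]addr0; apply: dpsi.
by rewrite (linearfD _ _ lphi) (linearfZ _ _ lphi) !hphi !psiK.
Qed.

End VectorFields.

(** * The filtered ring of continuous endomorphisms *)

Section ContinuousEndomorphisms.
Variables (K : comNzRingType) (gK : even_grading K) (V : free_gmod gK).
Notation L := (lhat V).

Definition cend_pred : {pred L -> L} := fun f => `[< cont_endo f >].

Fact cend_zmod_closed : zmod_closed cend_pred.
Proof.
split=> [|f g /asboolP cf /asboolP cg]; apply/asboolP; first exact: cont_endo0.
exact: cont_endoB.
Qed.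

HB.instance Definition _ := GRing.isZmodClosed.Build (L -> L) cend_pred cend_zmod_closed.

(** Bundling turns composition into the product of a ring, so that comparisons of leading terms
    become ring identities. The ring may be zero, namely for [V = 0]. *)
Record cend := CEnd { cfun :> L -> L; cendP : cfun \in cend_pred }.

HB.instance Definition _ := [isSub for cfun].
HB.instance Definition _ := [Choice of cend by <:].
HB.instance Definition _ := [SubChoice_isSubZmodule of cend by <:].

Implicit Types (f g h : cend).

Lemma cend_cont f : cont_endo f.
Proof. exact/asboolP/cendP. Qed.

Lemma cend_linear f : linear f.
Proof. by case: (cend_cont f). Qed.

Fact cend_mul_subproof f g : (f \o g) \in cend_pred.
Proof. exact/asboolP/cont_endo_comp/cend_cont/cend_cont. Qed.

Fact cend_one_subproof : id \in cend_pred.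
Proof. exact/asboolP/cont_endo_id. Qed.

Definition cend_mul f g : cend := CEnd (cend_mul_subproof f g).
Definition cend_one : cend := CEnd cend_one_subproof.

Fact cend_mulA : associative cend_mul.
Proof. by move=> f g h; apply: val_inj. Qed.

Fact cend_mul1l : left_id cend_one cend_mul.
Proof. by move=> f; apply: val_inj. Qed.

Fact cend_mul1r : right_id cend_one cend_mul.
Proof. by move=> f; apply: val_inj. Qed.

Fact cend_mulDl : left_distributive cend_mul +%R.
Proof. by move=> f g h; apply: val_inj. Qed.

Fact cend_mulDr : right_distributive cend_mul +%R.
Proof.
move=> f g h; apply/val_inj/funext => x.
exact: (linearfD (g x) (h x) (@cend_linear f)).
Qed.

HB.instance Definition _ := GRing.Zmodule_isPzRing.Build cend
  cend_mulA cend_mul1l cend_mul1r cend_mulDl cend_mulDr.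

Lemma cfun_sum (J : Type) (s : seq J) (P : pred J) (F : J -> cend) :
  cfun (\sum_(j <- s | P j) F j) = \sum_(j <- s | P j) cfun (F j).
Proof. by elim/big_ind2 : _ => // f u g v <- <-. Qed.

Lemma insub_cendE (u : L -> L) : cont_endo u -> cfun (insubd (0 : cend) u) = u.
Proof. by move=> cu; rewrite insubdK //; apply/asboolP. Qed.

(* Orders are shifted by one: [raises k] and [shifts k] describe endomorphisms
   of order at least [k + 1], respectively of order [k + 1]. *)
Definition raises k f := forall i (x : L), sorder_ge i x -> sorder_ge (i + k) (f x).
Definition shifts k f := forall i (x : L), sorder i x -> sorder (i + k) (f x).

Lemma raisesP k f : endo_ge k.+1 f <-> raises k f.
Proof.
split=> [[cf h]|h]; last first.
  by split=> [|i x ix]; [exact: cend_cont|rewrite addnS; exact/h/sorderW].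
by apply: cont_endo_ge => // i x /h; rewrite addnS.
Qed.

Lemma shiftsP k f : endo_order k.+1 f <-> shifts k f.
Proof. by split=> h i x /h; rewrite addnS. Qed.

Lemma raises0 k : raises k 0.
Proof. by []. Qed.

Lemma raisesB k f g : raises k f -> raises k g -> raises k (f - g).
Proof.
move=> hf hg i x ix w wi; rewrite -[LHS]/(lser (f x) w - lser (g x) w).
by rewrite (hf _ _ ix) // (hg _ _ ix) // subrr.
Qed.

Lemma raisesN k f : raises k f -> raises k (- f).
Proof. by move=> hf; rewrite -sub0r; apply: raisesB. Qed.

Lemma raisesD k f g : raises k f -> raises k g -> raises k (f + g).
Proof. by move=> hf hg; rewrite -[g]opprK; apply/raisesB/raisesN. Qed.

Lemma raises_sum k (J : eqType) (s : seq J) (P : pred J) (F : J -> cend) :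
  (forall j, j \in s -> P j -> raises k (F j)) -> raises k (\sum_(j <- s | P j) F j).
Proof.
move=> h; rewrite big_seq_cond; apply: big_ind; [exact: raises0|exact: raisesD|].
by move=> j /andP[]; exact: h.
Qed.

Lemma raisesW k l f : (l <= k)%N -> raises k f -> raises l f.
Proof. by move=> lk hf i x /hf; apply: sorder_geW; rewrite leq_add2l. Qed.

Lemma raisesM k l f g : raises k f -> raises l g -> raises (k + l) (f * g).
Proof. by move=> hf hg i x /hg/hf; rewrite -addnA [(l + k)%N]addnC. Qed.

Lemma raises1 : raises 0 1.
Proof. by move=> i x; rewrite addn0. Qed.

Lemma shiftsD k f g : shifts k f -> shifts k g -> shifts k (f + g).
Proof.
move=> hf hg i x ix w wi; rewrite -[LHS]/(lser (f x) w + lser (g x) w).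
by rewrite (hf _ _ ix) // (hg _ _ ix) // addr0.
Qed.

Lemma shiftsN k f : shifts k f -> shifts k (- f).
Proof.
move=> hf i x ix w wi; rewrite -[LHS]/(- lser (f x) w).
by rewrite (hf _ _ ix) // oppr0.
Qed.

Lemma shifts_sum k (J : eqType) (s : seq J) (P : pred J) (F : J -> cend) :
  (forall j, j \in s -> P j -> shifts k (F j)) -> shifts k (\sum_(j <- s | P j) F j).
Proof.
move=> h; rewrite big_seq_cond; apply: big_ind; [by []|exact: shiftsD|].
by move=> j /andP[]; exact: h.
Qed.

Lemma shiftsM k l f g : shifts k f -> shifts l g -> shifts (k + l) (f * g).
Proof. by move=> hf hg i x /hg/hf; rewrite -addnA [(l + k)%N]addnC. Qed.

Lemma shifts1 : shifts 0 1.
Proof. by move=> i x; rewrite addn0. Qed.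

Lemma shifts_raises k f : shifts k f -> raises k f.
Proof.
by move=> hf; apply: cont_endo_ge; [exact: cend_cont|move=> i x /hf/sorderW].
Qed.

(** * Leading terms of sums and squares *)

Lemma shifts_raises_eq0 k f : shifts k f -> raises k.+1 f -> f = 0.
Proof.
move=> hs hr; apply: val_inj; apply: (cont_endo_order_ge_eq0 (a := k)) => //.
  exact: cend_cont.
by move=> i x /hr; rewrite addnS.
Qed.

(** By strong induction each term below [N] vanishes: it has pure order, yet as the whole sum minus
    the other terms it also has larger order. The terms above [N] already raise orders by [N.+1]. *)
Lemma graded_sum_leading (D : nat -> cend) M N : (N < M)%N ->
  (forall k, shifts k (D k)) -> raises N (\sum_(k < M) D k) ->
  raises N.+1 (\sum_(k < M) D k - D N).
Proof.
move=> NM hD hN.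
have D0 k : (k < N)%N -> D k = 0.
  elim/ltn_ind: k => k ih kN; have kM := ltn_trans kN NM.
  apply: (shifts_raises_eq0 (hD k)).
  rewrite -[D k](addrK (\sum_(i < M | i != Ordinal kM) D i)).
  rewrite -(bigD1 (Ordinal kM) (P := xpredT)) //=; apply: raisesB.
    exact: raisesW kN hN.
  apply: raises_sum => i _ /eqP ik.
  have [ik'|ki|/eqP ki] := ltngtP i k.
  - by rewrite ih //; apply: ltn_trans kN.
  - exact: raisesW ki (shifts_raises (hD i)).
  - by case: ik; apply: val_inj; apply/eqP.
rewrite (bigD1 (Ordinal NM)) //= addrAC subrr add0r.
apply: raises_sum => i _ /eqP iN.
have [/D0 -> //|ki|/eqP ki] := ltngtP i N.
  exact: raisesW ki (shifts_raises (hD i)).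
by case: iN; apply: val_inj; apply/eqP.
Qed.

(** Regroups a double sum by total shift. It serves both the square of a total field and the
    expression [phi X - X' phi]. Components of orders [i] and [j] shift by [i - 1] and [j - 1],
    whence [i + j - 2]. *)
Lemma double_sum_leading (H : nat -> nat -> cend) a b n N : (0 < a)%N -> (0 < b)%N ->
  (forall i j, (a <= i < n)%N -> (b <= j < n)%N -> shifts (i + j - 2) (H i j)) ->
  raises N (\sum_(a <= i < n) \sum_(b <= j < n) H i j) ->
  let D := \sum_(a <= i < n) \sum_(b <= j < n | (i + j == N + 2)%N) H i j in
  shifts N D /\ raises N.+1 (\sum_(a <= i < n) \sum_(b <= j < n) H i j - D).
Proof.
move=> a0 b0 hH.
pose D k := \sum_(a <= i < n) \sum_(b <= j < n | (i + j == k + 2)%N) H i j.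
have hD k : shifts k (D k).
  apply: shifts_sum => i; rewrite mem_index_iota => ai _.
  apply: shifts_sum => j; rewrite mem_index_iota => bj /eqP ijk.
  by have := hH i j ai bj; rewrite ijk addnK.
(* The bound [N + n + n] exceeds both [N] and every shift [i + j - 2] that occurs. *)
have -> : \sum_(a <= i < n) \sum_(b <= j < n) H i j = \sum_(k < (N + n + n).+1) D k.
  rewrite /D [RHS]exchange_big /=; apply: eq_big_nat => i ai.
  under [RHS]eq_bigr => k _ do rewrite big_mkcond.
  rewrite [RHS]exchange_big /=; apply: eq_big_nat => j bj.
  have ijM : (i + j - 2 < (N + n + n).+1)%N by lia.
  rewrite (bigD1 (Ordinal ijM)) //= big1 ?addr0 => [|k /eqP kij].
    by rewrite ifT //; lia.
  rewrite ifF //; apply/eqP => E; apply: kij; apply: val_inj => /=; lia.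
by move=> hN /=; split=> //; apply: graded_sum_leading => //; lia.
Qed.

(** Replacing [X] by [a] and [r] by [b] in the cross terms costs only higher order. The term [r * r]
    raises by [2 * (n - 1)], which is at least [n + 1] exactly because [n] is at least 3. *)
Lemma square_leading n (X a r b : cend) : (3 <= n)%N ->
  raises 1 X -> raises 2 (X - a) -> raises n.-1 r -> raises n (r - b) ->
  raises n.+1 ((X + r) * (X + r) - (X * X + (a * b + b * a))).
Proof.
move=> n3 hX hXa hr hrb.
have ha : raises 1 a.
  by rewrite -[a](subKr X); apply: raisesB => //; apply: raisesW hXa.
have hb : raises n.-1 b.
  by rewrite -[b](subKr r); apply: raisesB => //; apply: raisesW hrb; lia.
have -> : (X + r) * (X + r) - (X * X + (a * b + b * a)) =
    ((X - a) * r + a * (r - b)) + (r * (X - a) + (r - b) * a) + r * r.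
  have Xr : X * r = (X - a) * r + a * (r - b) + a * b.
    by rewrite mulrBl mulrBr addrA subrK subrK.
  have rX : r * X = r * (X - a) + (r - b) * a + b * a.
    by rewrite mulrBl mulrBr addrA subrK subrK.
  rewrite mulrDl (mulrDr X) (mulrDr r) Xr rX -[X * X + _ + _]addrA opprD addrACA subrr add0r.
  by apply/eqP; rewrite subr_eq (AC (2*(2*1)) ((1*3*5)*(2*4))).
have n1 : n.+1 = (2 + n.-1)%N by lia.
apply: raisesD; first apply: raisesD; first apply: raisesD.
- by rewrite n1; apply: raisesM.
- by rewrite -add1n; apply: raisesM.
- apply: raisesD; first by rewrite n1 addnC; apply: raisesM.
  by rewrite -addn1; apply: raisesM.
by apply: (@raisesW (n.-1 + n.-1)); [lia|apply: raisesM].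
Qed.

End ContinuousEndomorphisms.

(** * The obstruction cochain *)

Section MinimalStructures.
Variables (K : comNzRingType) (gK : even_grading K) (V : free_gmod gK).
Notation L := (lhat V).

Lemma dbr11 (f g : cend V) : dbr 1 1 f g = cfun (f * g + g * f).
Proof.
by rewrite /dbr /koszul mulr1 expr1 scaleN1r opprK.
Qed.

Lemma koszul12 : koszul K 1 2 = 1.
Proof. by rewrite /koszul mul1r sqrrN expr1n. Qed.

Lemma dbr12 (f g : cend V) : dbr 1 2 f g = cfun (f * g - g * f).
Proof. by rewrite /dbr koszul12 scale1r. Qed.

(** The default [0] makes this total in [i], since [m i] may fail to be continuous outside the range
    of the structure. *)
Definition ccomp (m : nat -> L -> L) (i : nat) : cend V := insubd 0 (m i).

Definition ctotal n m : cend V := \sum_(2 <= i < n) ccomp m i.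

(** The part of the square of the total field that has order [n + 1]. Composites instead of
    commutators avoid the factor one half and make sense over any base ring. *)
Definition cobs n m : cend V :=
  \sum_(2 <= i < n) \sum_(2 <= j < n | (i + j == n + 2)%N) ccomp m i * ccomp m j.

Variables (n : nat) (m : nat -> L -> L).
Hypothesis (mP : is_minCn n m).

Lemma minCn_cont i : (2 <= i < n)%N -> cont_endo (m i).
Proof. by case: mP => + _ => /[apply] -[[]]. Qed.

Lemma ccompE i : (2 <= i < n)%N -> cfun (ccomp m i) = m i.
Proof. by move=> /minCn_cont; exact: insub_cendE. Qed.

Lemma ccomp_shifts i : (2 <= i < n)%N -> shifts i.-1 (ccomp m i).
Proof.
move=> ni; apply/shiftsP; rewrite ccompE // prednK; last by lia.
by case: mP => /(_ _ ni)[].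
Qed.

Lemma ctotalE : cfun (ctotal n m) = totalf n m.
Proof. by rewrite cfun_sum; apply: eq_big_nat => i; exact: ccompE. Qed.

Lemma vfield_total : vfield 1 (totalf n m).
Proof.
apply: vfield_sum => i; rewrite mem_index_iota => ni _.
by case: mP => /(_ _ ni)[].
Qed.

Lemma ctotal_sq_raises : raises n (ctotal n m * ctotal n m).
Proof. by apply/raisesP; case: mP => _; rewrite -ctotalE. Qed.

Lemma ctotal_sq_leading :
  shifts n (cobs n m) /\ raises n.+1 (ctotal n m * ctotal n m - cobs n m).
Proof.
have := ctotal_sq_raises; rewrite /ctotal big_distrlr /=.
apply: double_sum_leading => // i j ni nj.
have -> : (i + j - 2 = i.-1 + j.-1)%N by lia.
by apply: shiftsM; exact: ccomp_shifts.
Qed.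

Lemma ctotal_leading : (3 <= n)%N ->
  raises 1 (ctotal n m) /\ raises 2 (ctotal n m - ccomp m 2).
Proof.
move=> n3; split; last first.
  rewrite /ctotal big_ltn // addrAC subrr add0r.
  apply: raises_sum => i; rewrite mem_index_iota => ni _.
  by apply: (@raisesW _ _ _ i.-1); [lia|apply/shifts_raises/ccomp_shifts; lia].
apply: raises_sum => i; rewrite mem_index_iota => ni _.
by apply: (@raisesW _ _ _ i.-1); [lia|apply/shifts_raises/ccomp_shifts].
Qed.

Lemma cobs_commute : (3 <= n)%N ->
  ccomp m 2 * cobs n m - cobs n m * ccomp m 2 = 0.
Proof.
move=> n3; have [X1 X2] := ctotal_leading n3.
have [Os Or] := ctotal_sq_leading; have XX := ctotal_sq_raises.
set X := ctotal n m in X1 X2 Or XX *; set a := ccomp m 2 in X2 *.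
set O := cobs n m in Os Or *.
have a1 : shifts 1 a by apply: (@ccomp_shifts 2); lia.
apply: (@shifts_raises_eq0 _ _ _ n.+1).
  apply: shiftsD; first by rewrite -add1n; apply: shiftsM.
  by apply: shiftsN; rewrite -addn1; apply: shiftsM.
(* [X] commutes with [X * X], so only error terms remain. Each of them raises by [n + 2], whereas
   [a * O - O * a] shifts by exactly [n + 1]. *)
have -> : a * O - O * a = ((X * X - O) * a + (X * X) * (X - a))
                        - ((X - a) * (X * X) + a * (X * X - O)).
  rewrite !mulrBr !mulrBl [X * (X * X)]mulrA.
  rewrite [_ - O * a + _]addrC [X * X * X - _ + _]addrA subrK.
  by rewrite [X * X * X - a * _ + _]addrA subrK opprB [RHS]addrC addrA subrK.
have e1 : (n.+2 = 1 + n.+1)%N by []; have e2 : (n.+2 = 2 + n)%N by [].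
apply: raisesB; apply: raisesD.
- by rewrite e1 addnC; apply: raisesM => //; exact: shifts_raises.
- by rewrite e2 addnC; apply: raisesM.
- by rewrite e2; apply: raisesM.
- by rewrite e1; apply: raisesM => //; exact: shifts_raises.
Qed.

(** An index equal to 2 would force its partner to be [n], which is out of range. *)
Lemma cobs_sum3 : cobs n m =
  \sum_(3 <= i < n) \sum_(3 <= j < n | (i + j == n + 2)%N) ccomp m i * ccomp m j.
Proof.
rewrite /cobs; have [n2|n3] := leqP n 2; first by rewrite !big_geq //; lia.
rewrite big_ltn // [X in X + _](_ : _ = 0) ?add0r; last first.
  by rewrite big_nat_cond; apply: big1 => j; lia.
apply: eq_big_nat => i i1; rewrite big_mkcond [RHS]big_mkcond /= big_ltn //.
by rewrite ifF ?add0r //; lia.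
Qed.

(** Commutators of fields of degree one are anticommutators, so every composite is counted once for
    each ordering of the index pair. *)
Lemma sum_dbr : \sum_(3 <= i < n) \sum_(3 <= j < n | (i + j == n + 2)%N)
    dbr 1 1 (m i) (m j) = cobs n m + cobs n m.
Proof.
transitivity (cfun (\sum_(3 <= i < n) \sum_(3 <= j < n | (i + j == n + 2)%N)
    (ccomp m i * ccomp m j + ccomp m j * ccomp m i))).
  rewrite cfun_sum; apply: eq_big_nat => i i3.
  rewrite cfun_sum big_nat_cond [RHS]big_nat_cond; apply: eq_bigr => j /andP[j3 _].
  by rewrite -dbr11 !ccompE //; lia.
under eq_bigr => i _ do rewrite big_split /=.
rewrite big_split /= -cobs_sum3; congr (cfun (_ + _)).
rewrite cobs_sum3.
under eq_bigr => i _ do rewrite big_mkcond /=.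
rewrite exchange_big /=; apply: eq_bigr => i _.
by rewrite [RHS]big_mkcond /=; apply: eq_bigr => j _; rewrite addnC.
Qed.

(** The doubled cochain is visibly a sum of commutators of vector fields; halving is postponed until
    rational scalars are available. *)
Lemma vfield_sum_dbr : vfield 2 (cobs n m + cobs n m : L -> L).
Proof.
rewrite -sum_dbr; apply: vfield_sum => i; rewrite mem_index_iota => ni _.
apply: vfield_sum => j; rewrite mem_index_iota => nj _.
have [h _] := mP; have [|vi _] := h i; first by lia.
have [|vj _] := h j; first by lia.
exact: (@vfield_dbr _ _ _ 1 1).
Qed.

End MinimalStructures.

(** * Invariance under equivalence *)

Section Equivalence.
Variables (K : comNzRingType) (gK : even_grading K) (V : free_gmod gK).
Notation L := (lhat V).

(* [q x = x - (p - 1) (q x)], so the order of [q x] can be raised step by step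
   up to that of [x]. *)
Lemma raises_inverse (p q : cend V) : p * q = 1 -> raises 1 (p - 1) ->
  raises 0 q /\ raises 1 (q - 1).
Proof.
move=> pq p1; have qE : q = 1 - (p - 1) * q by rewrite mulrBl mul1r pq opprB addrC subrK.
have q0 : raises 0 q.
  move=> i x ix; rewrite addn0.
  have qxE w : lser (q x) w = lser x w - lser ((p - 1) (q x)) w by rewrite {1}qE.
  suff h k : (k <= i)%N -> sorder_ge k (q x) by exact: h.
  elim: k => [//|k ih ki] w wk.
  have ki' := ltnW ki; have pk := p1 _ _ (ih ki').
  by rewrite qxE pk ?addn1 // subr0 ix // (leq_trans wk).
split; [exact: q0|]; have -> : q - 1 = - ((p - 1) * q) by rewrite mulrBl mul1r pq opprB.
by apply: raisesN; rewrite -[1%N]addn0; apply: raisesM.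
Qed.

Variables (n : nat) (m m' : nat -> L -> L) (phi psi : L -> L).
Hypotheses (n3 : (3 <= n)%N) (mP : is_minCn n m) (mP' : is_minCn n m').
Hypotheses (phiK : diffeo_pair phi psi) (phiP : pointed phi).
Hypothesis (phim : endo_ge n (phi \o totalf n m \o psi - totalf n m')).

Lemma cobs_equiv : exists2 eta : cend V, vfield_ord n 1 eta &
  cobs n m - cobs n m' = ccomp m' 2 * eta + eta * ccomp m' 2.
Proof.
have [[cphi _ _] [cpsi _ _] psiphi phipsi] := phiK.
pose P : cend V := insubd 0 phi; pose Q : cend V := insubd 0 psi.
have PE : cfun P = phi := insub_cendE cphi.
have QE : cfun Q = psi := insub_cendE cpsi.
have PQ : P * Q = 1.
  by apply/val_inj/funext => x; rewrite -[LHS]/(cfun P (cfun Q x)) PE QE phipsi.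
have QP : Q * P = 1.
  by apply/val_inj/funext => x; rewrite -[LHS]/(cfun Q (cfun P x)) PE QE psiphi.
pose X := ctotal n m; pose Y := ctotal n m'.
pose r := P * X * Q - Y.
have rE : cfun r = phi \o totalf n m \o psi - totalf n m'.
  by rewrite -ctotalE // -ctotalE // -PE -QE.
have nE : n = n.-1.+1 by lia.
have hr : raises n.-1 r by apply/raisesP; rewrite -nE rE.
have [phi_ [hphi_ phiN]] := phiP.
(* Index 1 receives the identity, the component of order 1 of a pointed diffeomorphism, so that
   [phi] is approximated by sums starting at 1. *)
pose p i : cend V := if i == 1%N then (1 : cend V) else (insubd 0 (phi_ i) : cend V).
have pE i : (2 <= i)%N -> cfun (p i) = phi_ i.
  move=> i2; rewrite /p ifF; last by lia.
  by apply: insub_cendE; case: (hphi_ _ i2).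
have ps i : (1 <= i)%N -> shifts i.-1 (p i).
  move=> i1; have [->|ni1] := eqVneq i 1%N; first exact: shifts1.
  apply/shiftsP; rewrite pE ?prednK //; last by lia.
  by case: (hphi_ i); first by lia.
have hP N : (2 <= N)%N -> raises N.-1 (P - \sum_(1 <= i < N) p i).
  move=> N2; apply/raisesP; rewrite prednK; last by lia.
  suff -> : cfun (P - \sum_(1 <= i < N) p i) = phi - id - \sum_(2 <= i < N) phi_ i.
    exact: phiN.
  rewrite big_ltn // opprD addrA.
  rewrite -[LHS]/(cfun P - id - cfun (\sum_(2 <= i < N) p i)) PE cfun_sum.
  by congr (_ - _); apply: eq_big_nat => i /andP[i2 _]; rewrite pE.
have P1 : raises 1 (P - 1) by have := hP 2%N erefl; rewrite big_nat1.
have P0 : raises 0 P.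
  by rewrite -[P](subrK 1); apply: raisesD; [exact: raisesW P1|exact: raises1].
have [Q0 Q1] := raises_inverse PQ P1.
have [X1 X2] := ctotal_leading mP n3; have [Y1 Y2] := ctotal_leading mP' n3.
have [Os Or] := ctotal_sq_leading mP; have XX := ctotal_sq_raises mP.
have [Os' Or'] := ctotal_sq_leading mP'.
rewrite -/X in X1 X2 Or XX; rewrite -/Y in Y1 Y2 Or'.
set O := cobs n m in Os Or *; set O' := cobs n m' in Os' Or' *.
set a := ccomp m' 2 in Y2 *.
pose H i j := p i * ccomp m j - ccomp m' j * p i.
pose S := \sum_(1 <= i < n) p i.
have HE : \sum_(1 <= i < n) \sum_(2 <= j < n) H i j = S * X - Y * S.
  rewrite mulr_suml mulr_sumr -sumrB; apply: eq_bigr => i _.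
  by rewrite mulr_sumr mulr_suml -sumrB.
(* [r * P = P * X - Y * P] because [Q] inverts [P]. Truncating [P] to [S] alters this only by terms
   that raise by [n]. *)
have rP : r * P - (S * X - Y * S) = (P - S) * X - Y * (P - S).
  have -> : r * P = P * X - Y * P by rewrite mulrBl -!mulrA QP mulr1.
  by rewrite mulrBl mulrBr !opprD addrACA.
have hPS : raises n.-1 (P - S) by apply: hP; lia.
have hrP : raises n (r * P - (S * X - Y * S)).
  rewrite rP; apply: raisesB; first by rewrite nE -addn1; apply: raisesM.
  by rewrite nE -add1n; apply: raisesM.
have hSX : raises n.-1 (S * X - Y * S).
  rewrite -[_ - _](subKr (r * P)); apply: raisesB; last by apply: raisesW hrP; lia.
  by rewrite -[n.-1]addn0; apply: raisesM.
have Hs i j : (1 <= i < n)%N -> (2 <= j < n)%N -> shifts (i + j - 2) (H i j).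
  move=> ni nj; have [i1 _] := andP ni.
  apply: shiftsD; last apply: shiftsN.
    have -> : (i + j - 2 = i.-1 + j.-1)%N by lia.
    by apply: shiftsM; [exact: ps|exact: (ccomp_shifts mP)].
  have -> : (i + j - 2 = j.-1 + i.-1)%N by lia.
  by apply: shiftsM; [exact: (ccomp_shifts mP')|exact: ps].
(* [eta] is the part of [S * X - Y * S] that shifts by [n - 1], hence has order [n]. *)
move: (hSX); rewrite -HE => /(double_sum_leading (isT : 0 < 1)%N (isT : 0 < 2)%N Hs)[].
rewrite HE -nE; set eta : cend V := \sum_(1 <= i < n) _ => etas heta.
have reta : raises n (r - eta).
  have -> : r - eta = - (r * (P - 1)) + ((r * P - (S * X - Y * S)) + ((S * X - Y * S) - eta)).
    set T := S * X - Y * S.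
    by rewrite [r * P - T + _]addrA subrK mulrBr mulr1 opprB addrA subrK.
  apply: raisesD; last exact: raisesD.
  by apply: raisesN; rewrite nE -addn1; apply: raisesM.
exists eta.
  split; last by rewrite nE; apply/shiftsP.
  (* The truncation defining [eta] hides the derivation rule; it is inherited from [r], a difference
     of vector fields. *)
  apply: (@vfield_leading _ _ _ n.-1 1 r) => //.
  - by rewrite rE; apply: vfieldB; [apply: vfield_conj|]; rewrite //; apply: vfield_total.
  - exact: cend_cont.
  - by move=> i x /reta; rewrite -addnS -nE.
have := square_leading n3 Y1 Y2 hr reta.
rewrite [Y + r]addrC subrK => sq.
have PXQ : P * X * Q * (P * X * Q) = P * (X * X) * Q.
  by rewrite -!mulrA [Q * (P * _)]mulrA QP mul1r.
rewrite PXQ in sq.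
set b := a * eta + eta * a in sq *.
apply/eqP; rewrite -subr_eq0; apply/eqP.
apply: (@shifts_raises_eq0 _ _ _ n).
  apply: shiftsD; first by apply: shiftsD => //; apply: shiftsN.
  apply: shiftsN; rewrite /b.
  have a1 : shifts 1 a by apply: (ccomp_shifts mP' (i := 2)); lia.
  have ae := shiftsM a1 etas; have ea := shiftsM etas a1.
  rewrite add1n -nE in ae; rewrite addn1 -nE in ea.
  exact: shiftsD.
(* Conjugation by [P] preserves the leading term of [X * X]: the corrections contain a factor
   [Q - 1] or [P - 1], which raises by one more. *)
have -> : O - O' - b = (P * (X * X) * Q - (Y * Y + b)) + (Y * Y - O') - (X * X - O)
    - (P * (X * X) * (Q - 1) + (P - 1) * (X * X)).
  rewrite mulrBr mulrBl mulr1 mul1r [_ - P * (X * X) + _]addrA subrK.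
  rewrite !opprD !opprK !addrA.
  by rewrite [RHS](ACl ((8*6*3*4)*(1*9)*(5*2)*(10*7))) /= !subrr !addr0.
apply: raisesB.
  by apply: raisesB => //; exact: raisesD.
have XXP : raises n (P * (X * X)) by apply: (raisesM P0 XX).
apply: raisesD; first by rewrite -addn1; apply: raisesM.
by rewrite -add1n; apply: raisesM.
Qed.

End Equivalence.

(** * The obstruction class *)

(** Needed for the degree of [Obs]. Comparing the homogeneous components of [h + h] and 1 gives
    [c i + c i = 0] for nonzero [i], and multiplying by [h] gives [c i = 0]. *)
Lemma kdeg_half (K : comNzRingType) (gK : even_grading K) (h : K) :
  h + h = 1 -> gK 0 h.
Proof.
move=> hh; have [_ _ gen free] := kdeg_grading gK.
have [s [c [us gc hE]]] := gen h.
(* Degree 0, the degree of 1, is adjoined because [s] need not list it. *)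
pose s' := undup (0 :: s).
pose e i := (if i \in s then c i + c i else 0) - (if i == 0 then 1 else 0).
have ge i : gK i (e i).
  apply: kdegB; first by case: ifP => _; [exact: kdegD|exact: kdeg0].
  by case: eqP => [->|_]; [exact: kdeg1|exact: kdeg0].
have sum_s : \sum_(i <- s') (if i \in s then c i + c i else 0) = 1.
  rewrite -big_mkcond -big_filter -hh {1 2}hE -big_split /=.
  apply: perm_big; apply: uniq_perm => //; first exact/filter_uniq/undup_uniq.
  by move=> i; rewrite mem_filter mem_undup inE; case: (i \in s); rewrite ?orbT.
have sum_1 : \sum_(i <- s') (if i == 0 then 1 else 0 : K) = 1.
  rewrite -big_mkcond -big_filter (_ : [seq i <- s' | i == 0] = [:: 0]) ?big_seq1 //.
  apply: perm_small_eq => //; apply: uniq_perm => //; first exact/filter_uniq/undup_uniq.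
  by move=> i; rewrite mem_filter mem_undup !inE; case: eqP.
have e0 : forall i, i \in s' -> e i = 0.
  by apply: free => //; [exact: undup_uniq|rewrite sumrB sum_s sum_1 subrr].
rewrite hE big_seq; apply: big_ind => [||i si]; [exact: kdeg0|exact: kdegD|].
have [->|i0] := eqVneq i 0; first exact: gc.
have := e0 i; rewrite mem_undup inE si orbT /e si (negPf i0) subr0 => /(_ isT) cc.
by rewrite -[c i]mul1r -hh mulrDl -mulrDr cc mulr0; exact: kdeg0.
Qed.

Section ObstructionClass.
Variables (K : comAlgType rat) (gK : even_grading K) (V : free_gmod gK).
Variables (A : sgc_algebra V) (n : nat).
Hypothesis (n3 : (3 <= n)%N).
Notation L := (lhat V).
Implicit Types (m : minCn A n).

Let half : K := (2%:R^-1 : rat) *: (1 : K).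

Lemma halfD : half + half = 1.
Proof. by rewrite -scalerDl -[RHS]scale1r; congr (_ *: _). Qed.

Lemma ObsE m : Obs m = cfun (cobs n m).
Proof.
rewrite /Obs (sum_dbr (minCnP m)) -/half; apply/funext => x.
rewrite -[LHS]/(half *: (cobs n m x + cobs n m x)).
by rewrite scalerDr -scalerDl halfD scale1r.
Qed.

(** Order and continuity are read off from [cobs]; the degree and the derivation rule come from the
    doubled sum, multiplied by one half. *)
Lemma vfield_Obs m : vfield_ord n.+1 2 (Obs m).
Proof.
have mP := minCnP m; split; last first.
  by rewrite ObsE; apply/shiftsP; case: (ctotal_sq_leading mP).
split; first by rewrite ObsE; exact: cend_cont.
  rewrite /Obs (sum_dbr mP) -/half => j x jx w; have [_ h _] := vfield_sum_dbr mP.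
  by rewrite -[_ - _]add0r; apply: kdegM; [exact/kdeg_half/halfD|exact: h].
move=> j x y jx; rewrite /Obs (sum_dbr mP) -/half; have [_ _ h] := vfield_sum_dbr mP.
have fE z : (half *: (cobs n m + cobs n m : L -> L)) z
          = half *: (cobs n m + cobs n m : L -> L) z by [].
by rewrite !fE (h _ _ _ jx) lbrZl lbrZr scalerDr !scalerA [half * _]mulrC.
Qed.

Lemma ccomp2E m : cfun (ccomp m 2) = A.
Proof. by rewrite (ccompE (minCnP m)) ?comp2 // n3. Qed.

Lemma Obs_cocycle m : Obs m \in cocycle_pred A n.+1 3.
Proof.
apply/asboolP; split; first exact: vfield_Obs.
rewrite /harr_d (_ : 3 - 1 = 2) // ObsE -(ccomp2E m) dbr12.
by rewrite (cobs_commute (minCnP m)).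
Qed.

Definition obs_cocycle m : cocycle A n.+1 3 := Cocycle (Obs_cocycle m).

Lemma hclass_eqP i j (y z : cocycle A i j) : hclass y = hclass z <->
  exists2 eta, @harrC K gK V i.-1 (j - 1) eta &
    cocycle_val y - cocycle_val z = harr_d A (j - 1) eta.
Proof.
have E : (y - z \in @cobound_pred _ _ _ A i j) = (hclass y == hclass z).
  by rewrite Quotient.idealrBE.
split=> [/eqP|h]; first by rewrite -E => /asboolP.
by apply/eqP; rewrite -E; apply/asboolP.
Qed.

(** Cochains of bidegree [(n, 2)] are, after desuspension, vector fields of order [n] and degree
    one: exactly the candidates for a further component. *)
Lemma hclass_eq0 (z : cocycle A n.+1 3) : hclass z = 0 <->
  exists2 eta, vfield_ord n 1 eta & cocycle_val z = dbr 1 1 A eta.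
Proof.
have -> : 0 = hclass (0 : cocycle A n.+1 3) by rewrite /hclass raddf0.
split=> [/hclass_eqP[eta veta]|[eta veta E]].
  by rewrite subr0 => E; exists eta.
by apply/hclass_eqP; exists eta => //; rewrite subr0.
Qed.

Lemma minCn_equiv_refl m : minCn_equiv m m.
Proof.
have ce0 : cont_endo (0 : L -> L) := cont_endo0 V.
have e0 N : endo_ge N (0 : L -> L) by split.
exists id, id; split; last by rewrite subrr.
- by split=> //; split=> //; try exact: cont_endo_id; move=> j x; rewrite addr0.
exists (fun _ => 0); split=> [i _|N _]; first by split.
by rewrite big1 // subrr subr0.
Qed.

Lemma hclass_equiv m m' : minCn_equiv m m' ->
  hclass (obs_cocycle m) = hclass (obs_cocycle m').
Proof.
move=> [phi [psi [phiK phiP phim]]].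
have [eta veta E] := cobs_equiv n3 (minCnP m) (minCnP m') phiK phiP phim.
apply/hclass_eqP; exists eta => //=.
by rewrite !ObsE /harr_d -(ccomp2E m') [RHS]dbr11 -E.
Qed.

(** Adding [b] of order [n] changes the leading term of the squared total field from [O] to
    [O + (a * b + b * a)]; the extension is a minimal structure exactly when this vanishes. *)
Lemma extendableP m : extendable m <-> hclass (obs_cocycle m) = 0.
Proof.
have mP := minCnP m; have [X1 X2] := ctotal_leading mP n3.
have [Os Or] := ctotal_sq_leading mP.
set X := ctotal n m in X1 X2 Or; set a := ccomp m 2 in X2; set O := cobs n m in Os Or.
have nE : n.-1.+1 = n by lia.
have key (b : cend V) : shifts n.-1 b ->
    raises n.+1 ((X + b) * (X + b)) <-> O + (a * b + b * a) = 0.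
  move=> bs; have br := shifts_raises bs.
  have := square_leading n3 X1 X2 br (b := b); rewrite subrr.
  move=> /(_ (@raises0 _ _ _ _)) sq.
  have a1 : shifts 1 a by apply: (ccomp_shifts mP (i := 2)); lia.
  have ab := shiftsM a1 bs; have ba := shiftsM bs a1.
  rewrite add1n nE in ab; rewrite addn1 nE in ba.
  set c := a * b + b * a in sq *.
  have cs : shifts n c by exact: shiftsD.
  have cE : O + c = (X + b) * (X + b) - ((X + b) * (X + b) - (X * X + c)) - (X * X - O).
    by rewrite subKr [X * X + c]addrC -addrA opprB [X * X + _]addrC subrK addrC.
  split=> [sqr|oc].
    apply: (@shifts_raises_eq0 _ _ _ n); first exact: shiftsD.
    by rewrite cE; apply: raisesB => //; exact: raisesB.
  rewrite -[_ * _](subrK (X * X + c)); apply: raisesD => //.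
  rewrite -[X * X](subrK O) -addrA oc addr0; exact: Or.
have tot mn : totalf n.+1 (fun i => if i == n then mn else m i) = totalf n m + mn.
  rewrite /totalf big_nat_recr /=; last by lia.
  by rewrite eqxx; congr (_ + _); apply: eq_big_nat => i ni; rewrite ifF //; lia.
have aE : cfun a = A := ccomp2E m.
split=> [[mn [vmn [_]]]|/hclass_eq0[eta veta zE]].
  rewrite tot; have [[cmn _ _] omn] := vmn.
  pose b : cend V := insubd 0 mn; have bE : cfun b = mn := insub_cendE cmn.
  have bs : shifts n.-1 b by apply/shiftsP; rewrite nE bE.
  rewrite -(ctotalE mP) -bE => /(raisesP n.+1 ((X + b) * (X + b)))/(key b bs) oab.
  (* [O] has to be the bracket of [a] with the primitive, while extendability makes it minus the
     bracket with [b]; the converse uses the same change of sign. *)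
  apply/hclass_eq0; exists (- b : cend V).
    rewrite (_ : cfun (- b) = 0 - mn); last by rewrite sub0r -bE.
    by apply: vfield_ordB => //; exact: vfield_ord0.
  rewrite -aE dbr11 mulrN mulNr -opprD -[LHS]/(Obs m) ObsE; congr cfun.
  by apply/eqP; rewrite -addr_eq0; apply/eqP.
have [[ceta _ _] oeta] := veta.
pose b : cend V := - insubd 0 eta; have bE : cfun b = - eta.
  by rewrite -[LHS]/(- cfun (insubd 0 eta : cend V)) insub_cendE.
have vb : vfield_ord n 1 b.
  by rewrite bE -sub0r; apply: vfield_ordB => //; exact: vfield_ord0.
have bs : shifts n.-1 b by apply/shiftsP; rewrite nE; case: vb.
exists b; split=> //; split.
  move=> i ni; case: eqVneq => [-> //|ne]; case: mP => + _; apply; lia.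
rewrite tot -(ctotalE mP).
apply/(raisesP n.+1 ((X + b) * (X + b)))/(key b bs).
have OE : O = a * (- b) + (- b) * a.
  apply: val_inj; rewrite -[LHS]/(cfun O) -[RHS]/(cfun (a * - b + - b * a)).
  rewrite -dbr11 aE -[cfun (- b)]/(- cfun b) bE opprK -zE.
  by rewrite -[RHS]/(Obs m) ObsE.
by rewrite {1}OE mulrN mulNr -opprD addNr.
Qed.

End ObstructionClass.

(** * Descent to equivalence classes *)

Lemma Cset_inj (K : comAlgType rat) (gK : even_grading K) (V : free_gmod gK)
  (A : sgc_algebra V) (n : nat) : injective (@Cset K gK V A n).
Proof. by move=> [S SP] [T TP] /= ST; subst T; congr MkCn; exact: Prop_irrelevance. Qed.

Theorem theorem9p10 (K : comAlgType rat) (gK : even_grading K)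
    (V : free_gmod gK) (A : sgc_algebra V) (n : nat) (hn : (3 <= n)%N) :
  exists Obs_n : Cn A n -> HHarr A n.+1 3,
    [/\ forall m : minCn A n, exists z : cocycle A n.+1 3,
          cocycle_val z = Obs m /\ Obs_n (toCn m) = hclass z,
        [set toCn m | m in @extendable _ _ _ A n] = Obs_n @^-1` [set 0]
      & forall m : minCn A n, extendable m <-> Obs_n (toCn m) = 0].
Proof.
pose rep (c : Cn A n) := projT1 (cid (CsetP c)).
have repP c : Cset c = Cclass (rep c) := projT2 (cid (CsetP c)).
pose obs c := hclass (obs_cocycle hn (rep c)).
have obsE m : obs (toCn m) = hclass (obs_cocycle hn m).
  (* By reflexivity [m] lies in its own class, which is also the class of the chosen representative;
     hence the representative is equivalent to [m]. *)
  apply: hclass_equiv; have := minCn_equiv_refl m.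
  by rewrite -[minCn_equiv m m]/(Cset (toCn m) m) repP.
have extP m : extendable m <-> obs (toCn m) = 0 by rewrite obsE; exact: extendableP.
exists obs; split=> //; first by move=> m; exists (obs_cocycle hn m).
apply/seteqP; split=> [_ [m em <-]|c c0]; first exact/extP.
have cE : toCn (rep c) = c by apply: Cset_inj; rewrite [RHS]repP.
by exists (rep c) => //; apply/extP; rewrite cE.
Qed.
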